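(* Let $R=R_1\times R_2$, where $R_1$ and $R_2$ are commutative rings with $1\neq 0$, and let $Q$ be a proper ideal of $R$. Then the following conditions are equivalent: (1) $Q$ is a uniformly 2-absorbing primary ideal of $R$; (2) either $Q=Q_1\times R_2$ for some uniformly 2-absorbing primary ideal $Q_1$ of $R_1$, or $Q=R_1\times Q_2$ for some uniformly 2-absorbing primary ideal $Q_2$ of $R_2$, or $Q=Q_1\times Q_2$ for some uniformly primary ideal $Q_1$ of $R_1$ and some uniformly primary ideal $Q_2$ of $R_2$.
   Context: All rings are commutative with $1\neq 0$. A proper ideal $Q$ of a ring $R$ is uniformly primary if there exists a positive integer $n$ such that whenever $r,s\in R$ satisfy $rs\in Q$ and $r\notin Q$, then $s^n\in Q$. A proper ideal $Q$ of $R$ is uniformly 2-absorbing primary if there exists a positive integer $n$ such that whenever $a,b,c\in R$ satisfy $abc\in Q$, $ab\notin Q$ and $ac\notin\sqrt{Q}$, then $(bc)^n\in Q$. Here $\sqrt{Q}$ is the radical of $Q$. *)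

(* Defs.v *)
From mathcomp Require Import all_boot all_algebra.
From mathcomp Require Import all_classical.

Set Implicit Arguments.
Unset Strict Implicit.
Unset Printing Implicit Defensive.

Import GRing.Theory.

Local Open Scope ring_scope.
Local Open Scope classical_set_scope.

(* Ideals are arbitrary subsets [Q : set R]; the library's [idealr_closed]
   already requires [1 \notin Q].  For [set R], [x \in Q] is the classical
   reflection of [Q x], so no decidability is assumed. *)
Definition is_proper_ideal (R : comNzRingType) (Q : set R) : Prop :=
  idealr_closed [in Q].

Definition radical (R : comNzRingType) (Q : set R) : set R :=
  [set x | exists2 n : nat, (0 < n)%N & Q (x ^+ n)].

Definition uniformly_primary (R : comNzRingType) (Q : set R) : Prop :=
  is_proper_ideal Q /\
  exists2 n : nat, (0 < n)%N &
    forall r s : R, Q (r * s) -> ~ Q r -> Q (s ^+ n).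

Definition uniformly_2absorbing_primary (R : comNzRingType) (Q : set R) : Prop :=
  is_proper_ideal Q /\
  exists2 n : nat, (0 < n)%N &
    forall a b c : R,
      Q (a * b * c) -> ~ Q (a * b) -> ~ radical Q (a * c) -> Q ((b * c) ^+ n).

(* Main.v *)
Require Import Defs.
From mathcomp Require Import all_boot all_algebra.
From mathcomp Require Import all_classical.

(** Both conditions on an ideal are invariant under inverse image along a
surjective ring morphism, and [Q1 `*` Q2] is the intersection of the inverse
images of [Q1] and [Q2] under the two projections.  This reduces the theorem
to two facts about a single ring.

- The intersection of two uniformly primary ideals is uniformly 2-absorbing
  primary ([uniformly_2absorbing_primary_setI]).  If [a * b * c] lies in a
  primary ideal, then either a power of [b * c] lies in it, or both [a * b] and
  [a * c] do.  If the second alternative holds for one ideal, then [a * b] must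
  miss the other one, so a power of [c] is in that other ideal, which forces
  [a * c] into the radical of the intersection.

- If [Q] is uniformly 2-absorbing primary and [e] is an idempotent such that
  neither [e] nor [1 - e] is in [Q], then the colon ideal [(Q : e)] is uniformly
  primary ([uniformly_primary_colon]).

An ideal [Q] of [R1 * R2] is the product of its components
[Q1 = {x | (x, 0) in Q}] and [Q2 = {y | (0, y) in Q}].  If one of the two
idempotents [(1, 0)], [(0, 1)] is in [Q], the corresponding component is the
whole ring, and [Q] is the inverse image of the other component.  Otherwise the
second fact applies to both idempotents, whose colon ideals are the inverse
images of [Q1] and [Q2]. *)

Set Implicit Arguments.
Unset Strict Implicit.
Unset Printing Implicit Defensive.

Import GRing.Theory.

Local Open Scope ring_scope.
Local Open Scope classical_set_scope.

Section ProperIdeals.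
Variables (R : comNzRingType) (Q : set R).

Lemma is_proper_idealP :
  is_proper_ideal Q <->
  [/\ Q 0, ~ Q 1 & forall a x y, Q x -> Q y -> Q (a * x + y)].
Proof.
have QE x : (x \in [in Q]) = `[< Q x >] by [].
rewrite /is_proper_ideal /idealr_closed !QE.
split=> [[Q0 Q1 QD]|[Q0 Q1 QD]].
- split; [exact/asboolP | exact/asboolPn | ].
  by move=> a x y /asboolP Qx /asboolP Qy; apply/asboolP/QD.
- split; [exact/asboolP | exact/asboolPn | ].
  by move=> a x y /asboolP Qx /asboolP Qy; apply/asboolP/QD.
Qed.

Hypothesis idealQ : is_proper_ideal Q.

Lemma ideal_add x y : Q x -> Q y -> Q (x + y).
Proof.
by case/is_proper_idealP: idealQ => _ _ QD Qx Qy; rewrite -[x]mul1r; apply: QD.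
Qed.

Lemma ideal_mull a x : Q x -> Q (a * x).
Proof.
by case/is_proper_idealP: idealQ => Q0 _ QD Qx; rewrite -[_ * _]addr0; apply: QD.
Qed.

Lemma ideal_mulr a x : Q x -> Q (x * a).
Proof. by rewrite mulrC; apply: ideal_mull. Qed.

Lemma ideal_exp_le m n x : (m <= n)%N -> Q (x ^+ m) -> Q (x ^+ n).
Proof. by move=> /subnK <- Qx; rewrite exprD; apply: ideal_mull. Qed.

End ProperIdeals.

Section InverseImage.
Variables (R S : comNzRingType) (f : {rmorphism R -> S}) (Q : set S).

Lemma radical_preimage x : radical (f @^-1` Q) x <-> radical Q (f x).
Proof.
by split=> -[n n0 Qx]; exists n => //; move: Qx; rewrite /preimage /= rmorphXn.
Qed.

Lemma is_proper_ideal_preimage :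
  is_proper_ideal Q -> is_proper_ideal (f @^-1` Q).
Proof.
move=> /is_proper_idealP[Q0 Q1 QD]; apply/is_proper_idealP; split.
- by rewrite /preimage /= rmorph0.
- by rewrite /preimage /= rmorph1.
- by move=> a x y Qx Qy; rewrite /preimage /= rmorphD rmorphM; apply: QD.
Qed.

Lemma uniformly_primary_preimage :
  uniformly_primary Q -> uniformly_primary (f @^-1` Q).
Proof.
move=> [idQ [n n0 primQ]]; split; first exact: is_proper_ideal_preimage.
exists n => // r s; rewrite /preimage /= rmorphXn rmorphM; exact: primQ.
Qed.

Lemma uniformly_2absorbing_primary_preimage :
  uniformly_2absorbing_primary Q ->
  uniformly_2absorbing_primary (f @^-1` Q).
Proof.
move=> [idQ [n n0 absQ]]; split; first exact: is_proper_ideal_preimage.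
exists n => // a b c Qabc Qab Qac.
have := absQ (f a) (f b) (f c); rewrite -!rmorphM -rmorphXn; apply => //.
by move=> /radical_preimage.
Qed.

Hypothesis f_surj : forall y, exists x, f x = y.

Lemma is_proper_ideal_of_preimage :
  is_proper_ideal (f @^-1` Q) -> is_proper_ideal Q.
Proof.
move=> /is_proper_idealP[Q0 Q1 QD]; apply/is_proper_idealP; split.
- by rewrite -(rmorph0 f).
- by rewrite -(rmorph1 f).
- move=> a x y; have [[a' <-] [x' <-] [y' <-]] :=
    And3 (f_surj a) (f_surj x) (f_surj y).
  by rewrite -rmorphM -rmorphD; apply: QD.
Qed.

Lemma uniformly_primary_of_preimage :
  uniformly_primary (f @^-1` Q) -> uniformly_primary Q.
Proof.
move=> [idQ [n n0 primQ]]; split; first exact: is_proper_ideal_of_preimage.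
exists n => // r s; have [[r' <-] [s' <-]] := conj (f_surj r) (f_surj s).
by rewrite -rmorphM -rmorphXn; apply: primQ.
Qed.

Lemma uniformly_2absorbing_primary_of_preimage :
  uniformly_2absorbing_primary (f @^-1` Q) ->
  uniformly_2absorbing_primary Q.
Proof.
move=> [idQ [n n0 absQ]]; split; first exact: is_proper_ideal_of_preimage.
exists n => // a b c; have [[a' <-] [b' <-] [c' <-]] :=
  And3 (f_surj a) (f_surj b) (f_surj c).
rewrite -!rmorphM -rmorphXn => Qabc Qab Qac; apply: (absQ a') => //.
by move=> /radical_preimage.
Qed.

End InverseImage.

Section SingleRing.
Variable R : comNzRingType.

(** The only obstruction to [A ((b * c) ^+ n)] is that [A] contains both
[a * b] and [a * c].  Then [B] cannot contain [a * b], so it contains [c ^+ m],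
and [(a * c) ^+ m] is in both ideals. *)
Lemma primary_pair_absorb (A B : set R) (n m : nat) (a b c : R) :
    is_proper_ideal A -> is_proper_ideal B -> (0 < m)%N ->
    (forall r s, A (r * s) -> ~ A r -> A (s ^+ n)) ->
    (forall r s, B (r * s) -> ~ B r -> B (s ^+ m)) ->
    (A `&` B) (a * b * c) -> ~ (A `&` B) (a * b) ->
    ~ radical (A `&` B) (a * c) ->
  A ((b * c) ^+ n).
Proof.
move=> idA idB m0 primA primB [Aabc Babc] ABab radac; rewrite exprMn.
have [Aab|Aab] := pselect (A (a * b)); last first.
  by apply: (ideal_mull idA); apply: primA Aab.
have [Aac|Aac] := pselect (A (a * c)); last first.
  by apply: (ideal_mulr idA); apply: primA Aac; rewrite mulrAC.
exfalso; apply: radac; exists m => //; split.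
  by apply: (ideal_exp_le idA m0); rewrite expr1.
rewrite exprMn; apply: (ideal_mull idB); apply: (primB _ _ Babc) => Bab.
exact: ABab.
Qed.

Lemma uniformly_2absorbing_primary_setI (A B : set R) :
  uniformly_primary A -> uniformly_primary B ->
  uniformly_2absorbing_primary (A `&` B).
Proof.
move=> [idA [n n0 primA]] [idB [m m0 primB]]; split.
  move: (idA) (idB) => /is_proper_idealP[A0 A1 AD] /is_proper_idealP[B0 _ BD].
  apply/is_proper_idealP; split=> // [[]//|a x y [Ax Bx] [Ay By]].
  by split; [apply: AD | apply: BD].
exists (maxn n m); first by rewrite leq_max n0.
move=> a b c ABabc ABab radac; split.
  apply: (ideal_exp_le idA (leq_maxl n m)).
  exact: (primary_pair_absorb idA idB m0 primA primB ABabc).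
apply: (ideal_exp_le idB (leq_maxr n m)); rewrite setIC in ABabc ABab radac.
exact: (primary_pair_absorb idB idA n0 primB primA ABabc).
Qed.

(** With [r' = r * e + (1 - e)] and [s' = s * e + (1 - e)], the absorbing
condition is applied to [r'], [e], [s']: the factor [e] kills the complements,
so these products see only [r * s * e] and [r * e], whereas [r' * s'] keeps the
summand [1 - e] in all its powers and hence stays out of the radical. *)
Lemma uniformly_primary_colon (Q : set R) (e : R) :
    e * e = e -> ~ Q e -> ~ Q (1 - e) ->
  uniformly_2absorbing_primary Q -> uniformly_primary [set x | Q (e * x)].
Proof.
move=> ee Qe Qe' [idQ [n n0 absQ]]; split.
  move: (idQ) => /is_proper_idealP[Q0 _ QD]; apply/is_proper_idealP.
  split=> /=; rewrite ?mulr0 ?mulr1// => a x y Qx Qy.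
  by rewrite mulrDr mulrCA; apply: QD.
pose t x := x * e + (1 - e).
have te x : e * t x = e * x.
  by rewrite /t mulrDr mulrBr mulr1 ee subrr addr0 mulrCA ee mulrC.
have e't x : (1 - e) * t x = 1 - e.
  have e'e : (1 - e) * e = 0 by rewrite mulrBl mul1r ee subrr.
  by rewrite /t mulrDr mulrCA e'e mulr0 add0r mulrBr mulr1 e'e subr0.
exists n => // r s /= Qrs Qr.
(* [e ^+ n = e] because [0 < n]. *)
have -> : e * s ^+ n = (e * t s) ^+ n.
  rewrite te exprMn; congr (_ * _); case: n n0 {absQ} => // k _.
  by elim: k => // k IH; rewrite exprS -IH ee.
apply: (absQ (t r)).
- by rewrite [t r * e]mulrC te mulrAC te -mulrA [s * r]mulrC.
- by rewrite mulrC te.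
- move=> [k _ Qk]; apply: Qe'.
  suff -> : 1 - e = (1 - e) * (t r * t s) ^+ k by apply: ideal_mull.
  by elim: k {Qk} => [|k IH]; rewrite ?mulr1// exprS !mulrA !e't.
Qed.

End SingleRing.

Section Product.
Variables (R1 R2 : comNzRingType) (Q : set (R1 * R2)%type).

Lemma fst_surj (x : R1) : exists z : (R1 * R2)%type, fst z = x.
Proof. by exists (x, 0). Qed.

Lemma snd_surj (y : R2) : exists z : (R1 * R2)%type, snd z = y.
Proof. by exists (0, y). Qed.

Hypothesis idealQ : is_proper_ideal Q.

Lemma ideal_prodE : Q = [set x | Q (x, 0)] `*` [set y | Q (0, y)].
Proof.
apply/seteqP; split=> -[x y] /=.
- move=> Qxy; split.
  + have := ideal_mull idealQ (1, 0) Qxy.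
    by rewrite /GRing.mul /= /mul_pair /= mul1r mul0r.
  + have := ideal_mull idealQ (0, 1) Qxy.
    by rewrite /GRing.mul /= /mul_pair /= mul1r mul0r.
- move=> [Qx Qy]; have := ideal_add idealQ Qx Qy.
  by rewrite /GRing.add /= /add_pair /= addr0 add0r.
Qed.

End Product.

Theorem theorem2p31 (R1 R2 : comNzRingType) (Q : set (R1 * R2)%type)
    (hQ : is_proper_ideal Q) :
  uniformly_2absorbing_primary Q <->
  [\/ exists2 Q1 : set R1, uniformly_2absorbing_primary Q1 & Q = Q1 `*` setT,
      exists2 Q2 : set R2, uniformly_2absorbing_primary Q2 & Q = setT `*` Q2 |
      exists (Q1 : set R1) (Q2 : set R2),
        [/\ uniformly_primary Q1, uniformly_primary Q2 & Q = Q1 `*` Q2]].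
Proof.
have preim1 (A : set R1) : A `*` setT = @fst R1 R2 @^-1` A.
  by apply/seteqP; split=> z //= [].
have preim2 (B : set R2) : setT `*` B = @snd R1 R2 @^-1` B.
  by apply/seteqP; split=> z //= [].
split; last first.
- move=> [[Q1 abs1 ->]|[Q2 abs2 ->]|[Q1 [Q2 [prim1 prim2 ->]]]].
  + by rewrite preim1; apply: uniformly_2absorbing_primary_preimage.
  + by rewrite preim2; apply: uniformly_2absorbing_primary_preimage.
  + have -> : Q1 `*` Q2 = (@fst R1 R2 @^-1` Q1) `&` (@snd R1 R2 @^-1` Q2) by [].
    by apply: uniformly_2absorbing_primary_setI;
      apply: uniformly_primary_preimage.
move=> absQ; have QE := ideal_prodE hQ.
set Q1 := [set x | Q (x, 0)] in QE; set Q2 := [set y | Q (0, y)] in QE.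
have mulE (x x' : R1) (y y' : R2) : (x, y) * (x', y') = (x * x', y * y') by [].
have [Q10|Q10] := pselect (Q (1, 0)).
  have Q1T : Q1 = setT.
    apply/seteqP; split=> // x _; rewrite /Q1 /=.
    by have := ideal_mull hQ (x, 0) Q10; rewrite mulE mulr1 mulr0.
  apply: Or32; exists Q2; last by rewrite {1}QE Q1T.
  apply: (uniformly_2absorbing_primary_of_preimage (f := @snd R1 R2)).
    exact: snd_surj.
  by rewrite -preim2 -Q1T -QE.
have [Q01|Q01] := pselect (Q (0, 1)).
  have Q2T : Q2 = setT.
    apply/seteqP; split=> // y _; rewrite /Q2 /=.
    by have := ideal_mull hQ (0, y) Q01; rewrite mulE mulr1 mulr0.
  apply: Or31; exists Q1; last by rewrite {1}QE Q2T.
  apply: (uniformly_2absorbing_primary_of_preimage (f := @fst R1 R2)).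
    exact: fst_surj.
  by rewrite -preim1 -Q2T -QE.
have subE (x : R1) (y : R2) : 1 - (x, y) = (1 - x, 1 - y) by [].
apply: Or33; exists Q1, Q2; split=> //.
- apply: (uniformly_primary_of_preimage (f := @fst R1 R2)); first exact: fst_surj.
  have -> : fst @^-1` Q1 = [set z | Q ((1, 0) * z)].
    by apply/funext => -[x y]; rewrite /Q1 /preimage /= mulE mul1r mul0r.
  apply: uniformly_primary_colon => //.
    by rewrite mulE mulr1 mulr0.
  by rewrite subE subrr subr0.
- apply: (uniformly_primary_of_preimage (f := @snd R1 R2)); first exact: snd_surj.
  have -> : snd @^-1` Q2 = [set z | Q ((0, 1) * z)].
    by apply/funext => -[x y]; rewrite /Q2 /preimage /= mulE mul1r mul0r.
  apply: uniformly_primary_colon => //.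
    by rewrite mulE mulr1 mulr0.
  by rewrite subE subrr subr0.
Qed.
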